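(* Let $N\ge 2$ be an integer and $\frac58<\ell\le 1$. Define $m^0=0$ and $$m^n=\min\Big\{1,\frac{1+(\ell m^{n-1})^2}{2\ell}\Big\}\ (n\ge1),\qquad n_*=\inf\{n\ge1: m^{n+1}=1\},\qquad N_*=\min\{n_*,N\}$$ (with $\inf\emptyset=\infty$), and $$\delta_2=\frac{1-m^{N_*}}{8\ell}>0,\qquad \delta_1=\frac{3}{16\,\ell\, N_*(N_*+1)}>0.$$ Consider the Mann iteration with $N$ steps that runs the Perturbed Dual-Halpern iteration with $N_*$ iterations and parameters $\{m^i\}_{i=1}^{N_*},\delta_1,\delta_2$, followed by $N-N_*$ Picard iterations, and let $\{p_i^n\}_{0\le i\le n\le N}$ be its Mann coefficients. Assume that (1) for all $0\le i<j\le N$, $p_i^j\le p_i^{j-1}$; (2) for all $0\le i<j\le N$, $\sum_{l=i}^{j-1}p_l^j\le p_i^i$. Then the residual bound $R_N$ of this iteration satisfies $$R_N\le R_N^{\mathrm H}-\ell^{\,N-N_*+1}\Big(\frac{\delta_2^2}{3}+\delta_1^2\Big),$$ where $R_N^{\mathrm H}$ is the residual bound of the Halpern iteration with anchoring factors $\{m^i\}_{i=1}^N$.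
   Context: Mann iteration: for coefficients $\{a_i^n\}_{0\le i\le n\le N}$, nonnegative with $\sum_{i=0}^n a_i^n=1$ and $a_n^n>0$, and an operator $T$, $x^n=\sum_{i=0}^n a_i^n Tx^{i-1}$ for $0\le n\le N$, with the convention $Tx^{-1}:=x^0$. Residual bound: given the coefficients $\{a_i^n\}$ and $\ell\in(0,1]$, define recursively $d_{-1,-1}=0$, $d_{-1,i}=d_{i,-1}=1/\ell$ for $0\le i\le N$, and for $0\le i,j\le N$ $$d_{i,j}=\min_{z}\sum_{k=0}^i\sum_{l=0}^j z_{k,l}\,\ell\, d_{k-1,l-1},$$ the minimum being over arrays $z_{k,l}\ge0$ ($0\le k\le i$, $0\le l\le j$) with $\sum_{l=0}^j z_{k,l}=a_k^i$ for all $k$ and $\sum_{k=0}^i z_{k,l}=a_l^j$ for all $l$. The residual bound is $R_N=\sum_{n=0}^N a_n^N\,\ell\, d_{n-1,N}$. Halpern iteration with anchoring factors $\{m^i\}_{i=1}^N$: $x^n=(1-m^n)x^0+m^nTx^{n-1}$, $1\le n\le N$. As a Mann iteration, its coefficients are $a_0^0=1$, and for $n\ge1$: $a_0^n=1-m^n$, $a_n^n=m^n$, all others $0$. Picard iteration: $x^n=Tx^{n-1}$ (Mann row $a_n^n=1$, other entries $0$). Perturbed Dual-Halpern iteration with $K\ge2$ iterations and parameters $\{m^i\}_{i=1}^K,\delta_1,\delta_2$: $$x^1=(1-m^K+\delta_1)x^0+(m^K-\delta_1)Tx^0,$$ $$x^n=(1-m^K)x^0+\sum_{i=0}^{n-2}(m^{K-i}-m^{K-i-1})Tx^i+m^{K+1-n}Tx^{n-1}\quad(2\le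 n\le K-1),$$ $$x^K=(1-m^K-\delta_2)x^0+\sum_{i=0}^{K-2}(m^{K-i}-m^{K-i-1})Tx^i+(m^1+\delta_2)Tx^{K-1}.$$ In the claim it is used with $K=N_*$ (for the given data $N_*\ge2$) for $x^1,\dots,x^{N_*}$, and then $x^n=Tx^{n-1}$ for $N_*<n\le N$. The Mann coefficient $p_i^n$ is the coefficient of $Tx^{i-1}$ in the expression for $x^n$ ($p_0^n$ being the coefficient of $x^0$, and $p_0^0=1$). *)

(* Defs.v *)
From HB Require Import structures.
From mathcomp Require Import all_boot all_order all_algebra.
From mathcomp Require Import all_classical all_reals all_analysis.
Set Implicit Arguments.
Unset Strict Implicit.
Unset Printing Implicit Defensive.
Import Order.TTheory GRing.Theory Num.Theory.
Import numFieldNormedType.Exports.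
Local Open Scope classical_set_scope.
Local Open Scope ring_scope.

(* Coefficient arrays are functions [a : nat -> nat -> R]; [a n i] is the
   coefficient $a_i^n$ (row first). *)

Section ResidualBound.
Context {R : realType}.
Implicit Types (a : nat -> nat -> R) (mu nu : nat -> R) (l : R).

Definition mann_coeffs (N : nat) (a : nat -> nat -> R) : Prop :=
  forall n, (n <= N)%N ->
    [/\ forall i, (i <= n)%N -> 0 <= a n i,
        \sum_(i < n.+1) a n i = 1 & 0 < a n n].

Definition transport_plans (i j : nat) mu nu : set 'M[R]_(i.+1, j.+1) :=
  [set z | [/\ forall k q, 0 <= z k q,
               forall k : 'I_i.+1, \sum_(q < j.+1) z k q = mu k &
               forall q : 'I_j.+1, \sum_(k < i.+1) z k q = nu q]].

Definition plan_cost (i j : nat) (c : nat -> nat -> R) (z : 'M[R]_(i.+1, j.+1))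
  : R := \sum_(k < i.+1) \sum_(q < j.+1) z k q * c k q.

(* Written as an infimum; it is attained when the marginals are probability
   vectors, see [min_plan_costP], hence at every entry of the distance table of
   a Mann iteration, see [res_dist_minP]. *)
Definition min_plan_cost (i j : nat) mu nu (c : nat -> nat -> R) : R :=
  inf [set plan_cost c z | z in @transport_plans i j mu nu].

(* Indices are shifted by one: [res_dist a l i j] is $d_{i-1,j-1}$.
   The recursion for $d_{i,j}$ only uses first indices at most $i-1$, so
   [i] levels of unfolding suffice; see [res_distSS]. *)
Fixpoint res_dist_rec a l (fuel i j : nat) : R :=
  match i, j with
  | 0, 0 => 0
  | 0, _.+1 | _.+1, 0 => l^-1
  | i'.+1, j'.+1 =>
      if fuel is f.+1
      then @min_plan_cost i' j' (a i') (a j')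
             (fun k q => l * res_dist_rec a l f k q)
      else 0
  end.

Definition res_dist a l (i j : nat) : R := res_dist_rec a l i i j.

Definition residual_bound (N : nat) a l : R :=
  \sum_(n < N.+1) a N n * (l * res_dist a l n N.+1).

Lemma eq_min_plan_cost i j mu nu (c c' : nat -> nat -> R) :
  (forall k q, (k <= i)%N -> c k q = c' k q) ->
  @min_plan_cost i j mu nu c = @min_plan_cost i j mu nu c'.
Proof.
move=> cc'; rewrite /min_plan_cost; congr (inf _).
apply: eq_imagel => z _; apply: eq_bigr => k _; apply: eq_bigr => q _.
by rewrite cc' // -ltnS.
Qed.

Lemma res_dist_rec_fuel a l f i j :
  (i <= f)%N -> res_dist_rec a l f i j = res_dist a l i j.
Proof.
rewrite /res_dist; have [n] := ubnP i; elim: n f i j => // n IH f i j.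
case: i => [|i]; first by case: f; case: j.
case: f => [//|f]; case: j => [//|j] /= ni fi.
apply: eq_min_plan_cost => k q ki; congr (_ * _).
have kn : (k < n)%N := leq_ltn_trans ki ni.
by rewrite IH ?(leq_trans ki) // [RHS]IH.
Qed.

Lemma res_distSS a l i j :
  res_dist a l i.+1 j.+1 =
  @min_plan_cost i j (a i) (a j) (fun k q => l * res_dist a l k q).
Proof.
rewrite {1}/res_dist /=; apply: eq_min_plan_cost => k q ki.
by rewrite res_dist_rec_fuel.
Qed.

Lemma transport_plans_nonempty i j mu nu :
  (forall k, (k <= i)%N -> 0 <= mu k) -> (forall q, (q <= j)%N -> 0 <= nu q) ->
  \sum_(k < i.+1) mu k = 1 -> \sum_(q < j.+1) nu q = 1 ->
  @transport_plans i j mu nu !=set0.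
Proof.
move=> mu0 nu0 mu1 nu1; exists (\matrix_(k, q) (mu k * nu q)); split.
- by move=> k q; rewrite mxE mulr_ge0 ?mu0 ?nu0 // -ltnS.
- move=> k; under eq_bigr do rewrite mxE.
  by rewrite -mulr_sumr nu1 mulr1.
- move=> q; under eq_bigr do rewrite mxE.
  by rewrite -mulr_suml mu1 mul1r.
Qed.

Lemma min_plan_costP i j mu nu c :
  (forall k, (k <= i)%N -> 0 <= mu k) -> (forall q, (q <= j)%N -> 0 <= nu q) ->
  \sum_(k < i.+1) mu k = 1 -> \sum_(q < j.+1) nu q = 1 ->
  (exists2 z, @transport_plans i j mu nu z &
     plan_cost c z = @min_plan_cost i j mu nu c) /\
  (forall z, @transport_plans i j mu nu z ->
     @min_plan_cost i j mu nu c <= plan_cost c z).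
Proof.
move=> mu0 nu0 mu1 nu1.
pose B := [set v : 'rV[R]_(i.+1 * j.+1) |
             transport_plans mu nu (vec_mx v : 'M[R]_(i.+1, j.+1))].
have vc k q : continuous (fun v : 'rV[R]_(i.+1 * j.+1) =>
                            (vec_mx v : 'M[R]_(i.+1, j.+1)) k q).
  rewrite (_ : (fun _ => _) = fun v : 'rV[R]_(i.+1 * j.+1) =>
                                v ord0 (mxvec_index k q)).
    exact: coord_continuous.
  by apply/funext => v; rewrite mxE.
have sumc (I : finType) (f : I -> 'rV[R]_(i.+1 * j.+1) -> R) :
    (forall k, continuous (f k)) -> continuous (fun v => \sum_k f k v).
  by move=> fc; apply: continuous_big => [|k _]; [exact: add_continuous|exact: fc].
have Bcl : closed B.
  have -> : B =
      (\bigcap_(kq in [set: 'I_i.+1 * 'I_j.+1])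
         [set v | 0 <= (vec_mx v : 'M[R]_(i.+1, j.+1)) kq.1 kq.2]) `&`
      ((\bigcap_(k in [set: 'I_i.+1])
         [set v | \sum_q (vec_mx v : 'M[R]_(i.+1, j.+1)) k q = mu k]) `&`
       (\bigcap_(q in [set: 'I_j.+1])
         [set v | \sum_k (vec_mx v : 'M[R]_(i.+1, j.+1)) k q = nu q])).
    apply/seteqP; split => v /=.
      by case=> h1 h2 h3; split; [move=> [k q] _ /=|split=> k _ /=].
    by case=> h1 [h2 h3]; split => [k q|k|q];
      [exact: (h1 (k, q))|exact: h2|exact: h3].
  apply: closedI; last apply: closedI; apply: closed_bigI.
  - move=> [k q] _ /=.
    by apply: (@preimage_closed _ _ _ [set x : R | 0 <= x]);
      [move=> ? _; exact: vc|exact: closed_ge].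
  - move=> k _; apply: (@preimage_closed _ _ _ [set x : R | x = mu k]).
      by move=> ? _; apply: sumc => q; exact: vc.
    exact: closed_eq.
  - move=> q _; apply: (@preimage_closed _ _ _ [set x : R | x = nu q]).
      by move=> ? _; apply: sumc => k; exact: vc.
    exact: closed_eq.
have Bc : compact B.
  apply: (subclosed_compact Bcl
    (@rV_compact R _ (fun=> `[0, 1]%classic) (fun=> @segment_compact R 0 1))).
  move=> v [h1 h2 h3] s /=; case/mxvec_indexP: s => k q.
  have vE : v ord0 (mxvec_index k q) = (vec_mx v : 'M[R]_(i.+1, j.+1)) k q.
    by rewrite mxE.
  rewrite in_itv /= vE h1 /=.
  have muk : mu k <= 1.
    rewrite -mu1 (bigD1 k) //= lerDl; apply: sumr_ge0 => p _.
    by rewrite mu0 // -ltnS.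
  apply: le_trans muk; rewrite -(h2 k) (bigD1 q) //= lerDl.
  by apply: sumr_ge0 => p _; exact: h1.
have costc : continuous (fun v : 'rV[R]_(i.+1 * j.+1) =>
                plan_cost c (vec_mx v : 'M[R]_(i.+1, j.+1))).
  apply: (sumc _ _) => k; apply: (sumc _ _) => q v.
  by apply: (cvgM (vc k q v)); exact: cvg_cst.
have [z0 z0P] := transport_plans_nonempty mu0 nu0 mu1 nu1.
have B0 : B !=set0 by exists (mxvec z0); rewrite /B /= mxvecK.
have [v vB vmin] := EVT_min_rV B0 Bc (continuous_subspaceT costc).
rewrite inE in vB.
have zmin z : @transport_plans i j mu nu z ->
    plan_cost c (vec_mx v : 'M[R]_(i.+1, j.+1)) <= plan_cost c z.
  move=> zP; have := vmin (mxvec z); rewrite mxvecK; apply.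
  by rewrite inE /B /= mxvecK.
have lbE : @min_plan_cost i j mu nu c =
    plan_cost c (vec_mx v : 'M[R]_(i.+1, j.+1)).
  apply/eqP; rewrite eq_le; apply/andP; split.
    apply: ge_inf; last by exists (vec_mx v).
    by exists (plan_cost c (vec_mx v : 'M[R]_(i.+1, j.+1))) => _ [z zP <-];
      exact: zmin.
  apply: lb_le_inf; first by exists (plan_cost c z0), z0.
  by move=> _ [z zP <-]; exact: zmin.
by split; [exists (vec_mx v)|move=> z zP; rewrite lbE; exact: zmin].
Qed.

Lemma res_dist_minP N a l i j :
  mann_coeffs N a -> (i <= N)%N -> (j <= N)%N ->
  let c := fun k q => l * res_dist a l k q in
  (exists2 z, @transport_plans i j (a i) (a j) z &
     plan_cost c z = res_dist a l i.+1 j.+1) /\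
  (forall z, @transport_plans i j (a i) (a j) z ->
     res_dist a l i.+1 j.+1 <= plan_cost c z).
Proof.
move=> aP iN jN c; rewrite res_distSS.
have [ai0 ai1 _] := aP i iN; have [aj0 aj1 _] := aP j jN.
exact: min_plan_costP.
Qed.

End ResidualBound.

Section Iterations.
Context {R : realType}.
Implicit Types (m : nat -> R) (d l : R).

(* The Mann sequence is [x^n = \sum_i a_i^n T x^{i-1}] with [T x^{-1} = x^0];
   [mann_arg T x i] is $T x^{i-1}$. *)
Definition mann_arg (V : lmodType R) (T : V -> V) (x : nat -> V) (i : nat) : V :=
  if i is k.+1 then T (x k) else x 0.

Definition mann_iteration (N : nat) (a : nat -> nat -> R) (V : lmodType R)
    (T : V -> V) (x : nat -> V) : Prop :=
  forall n, (n <= N)%N -> x n = \sum_(i < n.+1) a n i *: mann_arg T x i.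

Definition halpern_coeff m (n i : nat) : R :=
  if n == 0 then (i == 0)%:R
  else if i == 0 then 1 - m n
  else if i == n then m n
  else 0.

Definition perturbed_dual_halpern (K : nat) m (d1 d2 : R) (V : lmodType R)
    (T : V -> V) (x : nat -> V) : Prop :=
  [/\ x 1 = (1 - m K + d1) *: x 0 + (m K - d1) *: T (x 0),
      forall n, (2 <= n <= K - 1)%N ->
        x n = (1 - m K) *: x 0
              + \sum_(0 <= i < n.-1) (m (K - i)%N - m (K - i - 1)%N) *: T (x i)
              + m (K + 1 - n)%N *: T (x n.-1) &
      x K = (1 - m K - d2) *: x 0
            + \sum_(0 <= i < K.-1) (m (K - i)%N - m (K - i - 1)%N) *: T (x i)
            + (m 1%N + d2) *: T (x K.-1)].

(* Coefficients of [K] perturbed Dual-Halpern steps followed by Picard steps;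
   the coefficient of $T x^{i-1}$ carries index [i], see [pdh_picard_coeffP]. *)
Definition pdh_picard_coeff (K : nat) m (d1 d2 : R) (n i : nat) : R :=
  if (n < i)%N then 0
  else if (K < n)%N then (i == n)%:R
  else if n == 0 then 1
  else if n == 1 then (if i == 0 then 1 - m K + d1 else m K - d1)
  else if i == 0 then (if n == K then 1 - m K - d2 else 1 - m K)
  else if (i < n)%N then m (K - i).+1 - m (K - i)%N
  else (if n == K then m 1%N + d2 else m (K + 1 - n)%N).

Lemma halpern_coeffP (N : nat) m (V : lmodType R) (T : V -> V) (x : nat -> V) :
  mann_iteration N (halpern_coeff m) T x <->
  forall n, (1 <= n <= N)%N -> x n = (1 - m n) *: x 0 + m n *: T (x n.-1).
Proof.
have E n : \sum_(i < n.+2) halpern_coeff m n.+1 i *: mann_arg T x i =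
           (1 - m n.+1) *: x 0 + m n.+1 *: T (x n).
  rewrite big_ord_recl big_ord_recr /= big1 ?add0r; last first.
    move=> i _; rewrite /halpern_coeff /= eqSS.
    by rewrite (ltn_eqF (ltn_ord i)) scale0r.
  by rewrite /halpern_coeff /= /bump /= add1n eqxx.
split=> [h [//|n] /= nN|h [|n] nN]; first by rewrite -E -h.
  by rewrite big_ord1 /halpern_coeff /= scale1r.
by rewrite E h.
Qed.

Lemma pdh_picard_coeffP (N K : nat) m (d1 d2 : R) (V : lmodType R) (T : V -> V)
    (x : nat -> V) : (2 <= K <= N)%N ->
  mann_iteration N (pdh_picard_coeff K m d1 d2) T x <->
  perturbed_dual_halpern K m d1 d2 T x /\
  (forall n, (K < n <= N)%N -> x n = T (x n.-1)).
Proof.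
move=> /andP[K2 KN].
have EP n : (K < n)%N ->
    \sum_(i < n.+1) pdh_picard_coeff K m d1 d2 n i *: mann_arg T x i =
    T (x n.-1).
  case: n => // n Kn; rewrite big_ord_recr big1 /= ?add0r; last first.
    move=> i _; rewrite /pdh_picard_coeff Kn ltnNge (ltnW (ltn_ord i)) /=.
    by rewrite (ltn_eqF (ltn_ord i)) scale0r.
  by rewrite /pdh_picard_coeff Kn ltnn eqxx scale1r.
have E n : (2 <= n <= K)%N ->
    \sum_(i < n.+1) pdh_picard_coeff K m d1 d2 n i *: mann_arg T x i =
    (if n == K then 1 - m K - d2 else 1 - m K) *: x 0
    + \sum_(0 <= i < n.-1) (m (K - i)%N - m (K - i - 1)%N) *: T (x i)
    + (if n == K then m 1%N + d2 else m (K + 1 - n)%N) *: T (x n.-1).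
  case: n => [//|[//|n]] /andP[_ nK].
  rewrite big_ord_recl big_ord_recr /= addrA big_mkord.
  rewrite /bump /= add1n; congr (_ *: _ + _ + _ *: _).
  - by rewrite /pdh_picard_coeff /= ltnNge nK.
  - apply: eq_bigr => i _; rewrite add1n /= /pdh_picard_coeff.
    have i1 : (i.+1 < n.+2)%N by rewrite ltnS; exact: ltn_ord.
    rewrite ltnNge (ltnW i1) /= (ltnNge K) nK /= i1.
    rewrite add0n -subnDA addn1 subnSK //.
    by rewrite (leq_trans _ nK) // ltnS ltnW // ltnS ltn_ord.
  - by rewrite /pdh_picard_coeff ltnn ltnNge nK.
have E1 : \sum_(i < 2) pdh_picard_coeff K m d1 d2 1 i *: mann_arg T x i =
    (1 - m K + d1) *: x 0 + (m K - d1) *: T (x 0).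
  by rewrite big_ord_recl big_ord1 /pdh_picard_coeff /= ltnNge (ltnW K2).
split=> [h|[[h1 h2 h3] h4] n nN].
  split; last by move=> n /andP[Kn nN]; rewrite -EP // -h.
  split; first by rewrite -E1 -h // (leq_trans (ltnW K2)).
    move=> n /andP[n2]; rewrite leq_subRL ?(ltnW K2) // add1n => nK.
    rewrite h ?(leq_trans (ltnW nK)) // E ?n2 ?(ltnW nK) //.
    by rewrite (ltn_eqF nK).
  by rewrite h // E ?K2 ?leqnn // eqxx.
have [Kn|nK] := ltnP K n; first by rewrite EP // h4 ?Kn.
case: n nN nK => [|[|n]] nN nK.
- by rewrite big_ord1 /pdh_picard_coeff /= scale1r.
- by rewrite E1.
rewrite E ?nK //; have [->//|nneK] := eqVneq n.+2 K.
rewrite h2 //= leq_subRL ?(ltnW K2) // add1n.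
by rewrite [(n.+2 < K)%N]ltn_neqAle nneK.
Qed.

Fixpoint opt_anchor l (n : nat) : R :=
  if n is k.+1 then Num.min 1 ((1 + (l * opt_anchor l k) ^+ 2) / (2 * l)) else 0.

(* [None] stands for $n_* = \infty$. *)
Definition n_star l : option nat :=
  if pselect (exists n, (1 <= n)%N && (opt_anchor l n.+1 == 1)) is left h
  then Some (ex_minn h) else None.

Definition N_star l (N : nat) : nat :=
  if n_star l is Some n then minn n N else N.

Definition delta2 l (N : nat) : R := (1 - opt_anchor l (N_star l N)) / (8 * l).

Definition delta1 l (N : nat) : R :=
  3 / (16 * l * (N_star l N)%:R * ((N_star l N)%:R + 1)).

Definition pert_coeff l (N : nat) : nat -> nat -> R :=
  pdh_picard_coeff (N_star l N) (opt_anchor l) (delta1 l N) (delta2 l N).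

End Iterations.

(* Main.v *)
Require Import Defs.
From mathcomp Require Import all_boot all_order all_algebra.
From mathcomp Require Import all_classical all_reals all_analysis.
From mathcomp Require Import ring lra zify.
Import Order.TTheory GRing.Theory Num.Theory.
Local Open Scope ring_scope.

(** Write c(i, j) for l times the distance with shifted indices i, j, as in
    [cost]; m for the optimal anchors, K for N_* and mu_k = l m^k. Up to K the
    anchors are not truncated, so mu_{k+1} = (1 + mu_k^2) / 2, a recursion that
    does not mention l.

    Each distance is the value of a linear program, and each residual bound is
    estimated on the side where one feasible point per distance is enough: dual
    potentials bound the Halpern residual from below ([cost_ge_dual]), transport
    plans bound the perturbed residual from above ([cost_le_plan]).

    Halpern. Rows n and n+1 are supported on {0, n} and {0, n+1}, so the only
    distances that matter are those of consecutive rows, and they satisfy a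
    scalar recursion ([halpern_cost_ge]). It yields 1 - l (m^K)^2 at step K and
    a factor l for each later step, where the anchor is 1
    ([halpern_residual_ge]). A Picard step costs the perturbed iteration the
    same factor l ([picard_residual_le]), so everything happens at step K.

    Dual-Halpern. The two hypotheses on the coefficients say that the following
    plan from row i to row j > i is feasible: the mass common to both rows
    stays, the last entry of row i feeds all positions from i to j, and every
    other surplus goes to j ([simple_plan]). Without perturbation the rows from
    1 on share all entries but the last, and the resulting bound on c(i+1, j+1) depends on
    i alone. The shift delta1 in row 1 makes the case j = i + 1 differ from
    j > i + 1 and creates a recursion for two sequences, [dist_bound true] and
    [dist_bound false]; the shift delta2 merely adds l delta2 to the distances
    to row K ([pdh_cost_le]).

    Perturbation. With eta = l delta, the shift delta1 changes l R_K by
    - eta1 (gain - near_weight * eta1), where the gain is of order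
    (log K) / K^2, and [near_weight_gain] says that
    gain >= (1 + near_weight) eta1 for the given delta1; this leaves - eta1^2.
    The shift delta2 changes l R_K by at most
    - eta2 (1 - mu_K - c - eta2), where c = dist_bound true (K - 1) is at most
    the product of all mu_k, hence at most 5/6 (1 - mu_K) ([dist_bound_last_le]).
    As 1 - mu_K >= 1 - m^K = 8 eta2, this leaves - eta2^2 / 3. The constant 5/6
    is sharp for the product, which equals 5/16 for K = 2. *)

(** * The scaled anchors and the two-sequence recursion *)

Section AnchorRecursion.
Context {R : realFieldType}.
Variables (K : nat) (mu : nat -> R).
Hypothesis mu0 : mu 0 = 0.
Hypothesis muS : forall k, (k < K)%N -> mu k.+1 = (1 + mu k ^+ 2) / 2.

Lemma mu_lt1 k : (k <= K)%N -> 0 <= mu k < 1.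
Proof.
elim: k => [|k IH] kK; first by rewrite mu0; lra.
by have := IH (ltnW kK); rewrite muS //; nra.
Qed.

Lemma mu_ge_half k : (0 < k <= K)%N -> 1 / 2 <= mu k.
Proof.
by case: k => // k /= kK; rewrite muS //; have := sqr_ge0 (mu k); lra.
Qed.

Lemma mu_step k : (k < K)%N -> mu k <= mu k.+1.
Proof. by move=> kK; rewrite muS //; have := sqr_ge0 (1 - mu k); nra. Qed.

Lemma gapS k : (k < K)%N -> 1 - mu k.+1 = (1 - mu k) * (1 - (1 - mu k) / 2).
Proof. by move=> kK; rewrite muS //; field. Qed.

Lemma gap_bounds k : (0 < k <= K)%N -> 0 < 1 - mu k <= 1 / 2.
Proof.
move=> /[dup] /mu_ge_half h /andP[_ /mu_lt1]; lra.
Qed.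

(** Unrolling the recursion of [dist_bound] from level K - 1 down to level
    K - 1 - j turns the residual into a combination of two entries;
    [near_weight j] is the weight of the entry for adjacent rows, and the two
    weights add up to 1 - mu_{j+1}, see [backward_sum]. *)
Fixpoint near_weight (j : nat) : R :=
  if j is i.+1
  then near_weight i * mu i + (1 - mu i.+1) * (mu i.+1 - mu i)
  else 1 / 2.

Lemma near_weightS i :
  near_weight i.+1
  = near_weight i * mu i + (1 - mu i.+1) * (mu i.+1 - mu i).
Proof. by []. Qed.

(** With x = 1 - mu_{j+1} and y = 1 - mu_j, so that x = y (1 - y/2), the
    recursion loses a factor 1 - y against (1 - x/2)^2 for x^2, a deficit of
    order y^2, and gains x y^2 / 2, which is of order y once divided by x^2.
    Any constant up to 16/9 works: j = 1 is the critical index. *)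
Lemma near_weight_ge j : (j < K)%N ->
  7 / 4 * (1 - mu j.+1) ^+ 2 <= near_weight j.
Proof.
case: j => [|j] jK; first by rewrite muS // mu0 /=; lra.
elim: j jK => [|j IH] jK.
  by rewrite /= !muS ?(ltnW jK) // mu0; lra.
have {IH} := IH (ltnW jK); rewrite [near_weight j.+2]near_weightS.
have /andP[y0 y1] : 0 < 1 - mu j.+1 <= 1 / 2 by apply: gap_bounds; lia.
have dE : mu j.+2 - mu j.+1 = (1 - mu j.+1) ^+ 2 / 2.
  by rewrite (muS j.+1) ?(ltnW jK) //; field.
rewrite dE !(gapS j.+2) // (gapS j.+1) ?(ltnW jK) //.
have {dE} : mu j.+1 = 1 - (1 - mu j.+1) by ring.
move: (1 - mu j.+1) (near_weight j.+1) y0 y1 => y w y0 y1 ->.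
(* q is the factor between consecutive gaps, so the next gap is y q *)
set q := 1 - y / 2 => hw.
have q0 : 3 / 4 <= q <= 1 by rewrite /q; lra.
have yq : y * q <= 3 / 8 by rewrite /q; nra.
have step : 0 <= 1 / 2 - 7 / 4 * (y * q) * (1 / 2 + q ^+ 2 / 4).
  have q2 : q ^+ 2 <= 1 by nra.
  have q2' : 0 <= q ^+ 2 by rewrite sqr_ge0.
  have yq0 : 0 <= y * q by nra.
  nra.
have yqy : 0 <= y ^+ 2 * (y * q) by nra.
have := mulr_ge0 yqy step.
have : 0 <= (w - 7 / 4 * (y * q) ^+ 2) * (1 - y) by apply: mulr_ge0; lra.
rewrite /q; lra.
Qed.

(** The inverse gaps start at 2 for k = 1 and grow by 1 / (2 - gap) <= 2/3 per
    step, so they stay below (2 k + 4) / 3. *)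
Lemma gap_ge k : (0 < k <= K)%N -> 3 / 2 <= (1 - mu k) * (k%:R + 2).
Proof.
case: k => // k /= kK; elim: k kK => [|k IH] kK; first by rewrite muS // mu0; lra.
have := IH (ltnW kK).
have /andP[y0 y1] : 0 < 1 - mu k.+1 <= 1 / 2 by apply: gap_bounds; lia.
rewrite (gapS k.+1) // -(natr1 k.+1).
move: (1 - mu k.+1) y0 y1 => y; move: k.+1%:R => n y0 y1 h.
have : 0 <= (y * (n + 2) - 3 / 2) * (1 - y / 2) by apply: mulr_ge0; lra.
nra.
Qed.

(** The right-hand side is the first-order gain of the perturbation of row 1 in
    a scheme with j + 2 steps. To leading order it is [near_weight] minus the
    squared gap (1 - mu_{j+1})^2, hence at least 3/4 of the squared gap by
    [near_weight_ge], while [gap_ge] bounds the step size on the left by 1/9 of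
    the squared gap once j > 0. *)
Lemma near_weight_gain j : (j.+1 < K)%N ->
  (1 + near_weight j) * (3 / (16 * (j.+2%:R * (j.+2%:R + 1)))) <=
  near_weight j * mu j
  - (1 - mu j.+1) * ((1 - mu j.+2) + (1 - mu j.+1) - (1 - mu j)).
Proof.
move=> jK; case: j jK => [|j] jK.
  have -> : 3 / (16 * (2%:R * (2%:R + 1))) = 1 / 32 :> R by field.
  by rewrite /= !muS ?(ltnW jK) // mu0; lra.
have := @near_weight_ge _ (ltnW jK).
have : (j.+3 <= K)%N by [].
have := @gap_ge j.+2; rewrite (ltnW jK) => /(_ isT).
have /andP[y0 y1] : 0 < 1 - mu j.+1 <= 1 / 2 by apply: gap_bounds; lia.
rewrite (gapS j.+2) // (gapS j.+1) ?(ltnW jK) //.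
have : mu j.+1 = 1 - (1 - mu j.+1) by ring.
move: (1 - mu j.+1) (near_weight j.+1) y0 y1 => y w y0 y1 ->.
(* y and y q are the gaps at j + 1 and j + 2, and n is j + 2; both sides are
   compared with multiples of the squared gap (y q)^2 *)
set q := 1 - y / 2.
have q0 : 3 / 4 <= q <= 1 by rewrite /q; lra.
have xE : y * q = y - y ^+ 2 / 2 by rewrite /q; field.
have x0 : 0 < y * q <= y by nra.
have n2 : 2 <= j.+2%:R :> R by rewrite ler_nat.
rewrite -(natr1 j.+2).
move: j.+2%:R n2 => n n2 hn _ hw.
have ewx : 3 / (16 * ((n + 1) * (n + 1 + 1))) <= (y * q) ^+ 2 / 9.
  rewrite ler_pdivrMr; last by nra.
  have : (3 / 2) ^+ 2 <= (y * q * (n + 2)) ^+ 2 by nra.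
  have : 0 <= (y * q) ^+ 2 by rewrite sqr_ge0.
  rewrite (exprMn _ (y * q)); set X := (y * q) ^+ 2 => X0 h.
  have -> : X / 9 * (16 * ((n + 1) * (n + 1 + 1))) =
    X * (n + 2) ^+ 2 * (4/3) + X * (n + 2) * (4 / 9) * (n - 2) by field.
  have : 0 <= X * (n + 2) * (4 / 9) * (n - 2) by rewrite !mulr_ge0 //; lra.
  lra.
have w0 : 0 <= w by have := sqr_ge0 (y * q); lra.
apply: (le_trans (ler_wpM2l _ ewx)); first lra.
have x2 : (y * q) ^+ 2 <= 1 / 4 by nra.
have : 0 <= (w - 7 / 4 * (y * q) ^+ 2) * (1 - y - (y * q) ^+ 2 / 9).
  by apply: mulr_ge0; lra.
have : 0 <= y * q * (y * q * (7 / 4 * (1 - y - (y * q) ^+ 2 / 9) - 10 / 9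
                               + (y * q) / 2 + y / 2)).
  rewrite !mulr_ge0 //; try lra.
  have : 3 / 4 * y <= y * q by nra.
  lra.
have : 0 <= (y * q) * (y * (y - y * q)) by rewrite !mulr_ge0 //; lra.
have -> : y * q * (1 - y * q / 2) + y * q - y =
          y * q - (y * q) ^+ 2 / 2 - y ^+ 2 / 2 by rewrite xE; field.
move: (y * q) => x; lra.
Qed.

(** Downward induction on the level: the weights of level i + 1 are pushed to
    level i by the recursion, and the weight mu_{K-i} - mu_{K-i-1} of the new
    summand keeps the total equal to 1 - mu because
    2 mu_{j+2} = 1 + mu_{j+1}^2. *)
Lemma backward_sum (A B : nat -> R) j : (j.+2 <= K)%N ->
  (forall i, (0 < i)%N -> (i.+1 < K)%N ->
     A i.+1 = mu (K - i.+1)%N * A i /\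
     B i.+1 = (mu (K - i.+1)%N - mu (K - i.+1).-1) * A i
              + mu (K - i.+1).-1 * B i) ->
  \sum_((K - j)%N <= n < K) (mu (K - n).+1 - mu (K - n)%N) * B n.-1
    + mu 1 * A K.-1 =
  near_weight j * A (K - j.+1)%N + ((1 - mu j.+1) - near_weight j) * B (K - j.+1)%N.
Proof.
move=> jK AB; elim: j jK => [|j IH] jK.
  by rewrite subn0 big_geq // subn1 (muS 0) ?(ltnW jK) //= mu0; field.
have [k0 k1 k2 k3] : [/\ (K - j.+1).+1 = (K - j)%N, (K - (K - j.+1))%N = j.+1,
  (K - j.+1).-1 = (K - j.+2)%N & (K - j.+2).+1 = (K - j.+1)%N] by split; lia.
rewrite big_ltn; last by lia.
have [||] := AB (K - j.+2)%N; [by lia|by lia|].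
rewrite k3 => E1 E2.
rewrite k0 k2 k1 /= in E1 E2 *; rewrite -addrA (IH (ltnW jK)) E1 E2.
rewrite (muS j.+1); last by lia.
by field.
Qed.

(** Bound on l d_{i,j} for 0 <= i < j in the scheme perturbed by e / l in row 1
    only; [adj] tells whether j = i + 1. Row 1 is the only one whose entry 0 is
    displaced, which is why [d] is e at i = 1 and 0 later. *)
Fixpoint dist_bound (e : R) (adj : bool) (i : nat) : R :=
  if i is i'.+1 then
    let d := if i' is 0 then e else 0 in
    d * (1 - dist_bound e adj i') +
    if adj then mu (K - i)%N * dist_bound e true i'
    else (mu (K - i)%N - mu (K - i).-1) * dist_bound e true i'
         + mu (K - i).-1 * dist_bound e false i'
  else if adj then mu K - e else mu K.

Let delta : R := 3 / (16 * (K%:R * (K%:R + 1))).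

Hypothesis K2 : (2 <= K)%N.

Lemma delta_bounds : 0 < delta <= 1 / 32.
Proof.
have k2 : 2 <= K%:R :> R by rewrite ler_nat.
have k3 : 6 <= K%:R * (K%:R + 1) :> R by nra.
by rewrite divr_gt0 /= ?ler_pdivrMr; lra.
Qed.

(** For delta = 0 the left-hand side is exactly mu_K (1 - mu_K). The
    perturbation of row 1 enters the recursion at levels 0 and 1 only, so
    [backward_sum] reduces the sum to those levels, where the effect of delta
    is read off. *)
Lemma residual_near_far :
  \sum_(1 <= n < K) (mu (K - n).+1 - mu (K - n)%N) * dist_bound delta false n.-1
    + mu 1 * dist_bound delta true K.-1 <= mu K * (1 - mu K) - delta ^+ 2.
Proof.
have [j KE] : exists j, K = j.+2 by exists K.-2; lia.
rewrite big_ltn //.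
have jK : (j.+2 <= K)%N by rewrite KE.
have rec i : (0 < i)%N -> (i.+1 < K)%N ->
    dist_bound delta true i.+1 = mu (K - i.+1)%N * dist_bound delta true i /\
    dist_bound delta false i.+1 =
      (mu (K - i.+1)%N - mu (K - i.+1).-1) * dist_bound delta true i
      + mu (K - i.+1).-1 * dist_bound delta false i.
  by case: i => // i _ _; rewrite /= !mul0r !add0r.
have := backward_sum _ _ _ jK rec.
have -> : (K - j)%N = 2%N by lia.
rewrite -[leLHS]addrA => ->.
have := @near_weight_gain j; rewrite KE ltnSn => /(_ isT); rewrite -KE -/delta.
have [-> ->] : (K - 1)%N = j.+1 /\ (K - j.+1)%N = 1%N by split; lia.
rewrite /=.
have -> : (K - 1)%N = j.+1 by lia.
have /andP[d0 _] := delta_bounds.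
have muK : mu K = (1 + mu j.+1 ^+ 2) / 2 by rewrite -muS KE.
(* the slack of the claim is delta times that of [near_weight_gain] *)
rewrite /= KE -KE => h; rewrite -subr_ge0.
have : 0 <= delta * (near_weight j * mu j - (1 - mu j.+1) *
   (1 - mu K + (1 - mu j.+1) - (1 - mu j)) - (1 + near_weight j) * delta).
  by rewrite mulr_ge0 // ?subr_ge0 // ltW.
congr (0 <= _); rewrite muK; clearbody delta.
move: (near_weight j) (mu j) (mu j.+1) delta => w p q d.
by field.
Qed.

(** The product is multiplied by (1 + mu^2) / 2 at each step and the gap by
    (1 + mu) / 2, which is larger; at k = 2 both sides equal 5/16. *)
Lemma prod_mu_le k : (2 <= k <= K)%N ->
  \prod_(1 <= q < k.+1) mu q <= 5 / 6 * (1 - mu k).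
Proof.
case: k => [|[|k]] //= kK; elim: k kK => [|k IH] kK.
  by rewrite big_ltn // big_nat1 (muS 1) // (muS 0) ?(ltnW kK) // mu0; lra.
rewrite big_nat_recr //= (gapS k.+2) // (muS k.+2) //.
have := IH (ltnW kK).
have /andP[y0 y1] := @mu_lt1 k.+2 (ltnW kK).
move: (\prod_(_ <= _ < _) _) (mu _) y0 y1 => P y y0 y1 h.
have : 0 <= (5 / 6 * (1 - y) - P) * (1 + y ^+ 2).
  by apply: mulr_ge0; [lra|have := sqr_ge0 y; lra].
have : 0 <= (1 - y) * (y * (1 - y)) by rewrite !mulr_ge0 //; lra.
lra.
Qed.

(** Each level multiplies the entry for adjacent rows by one scaled anchor. At
    level 1 the perturbation contributes
    delta (1 + delta - mu_{K-1} - mu_K), which is negative because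
    mu_{K-1} + mu_K >= 1/2 + 5/8. *)
Lemma dist_bound_adj_le i : (0 < i < K)%N ->
  dist_bound delta true i <= \prod_((K - i)%N <= q < K.+1) mu q.
Proof.
have /andP[d0 d1] := delta_bounds.
case: i => // i /= iK; elim: i iK => [|i IH] iK.
  rewrite subn1 big_ltn; last lia.
  have -> : K.-1.+1 = K by lia.
  rewrite big_nat1 /=.
  have : 1 / 2 <= mu K.-1 by apply: mu_ge_half; lia.
  have -> : mu K = (1 + mu K.-1 ^+ 2) / 2 by rewrite -muS ?prednK //; lia.
  move: (mu _) => x x2.
  have x2_ge : 1 / 4 <= x ^+ 2 by nra.
  by nra.
rewrite big_ltn; last lia.
have -> : (K - i.+2).+1 = (K - i.+1)%N by lia.
rewrite [dist_bound _ _ _]/= mul0r add0r ler_wpM2l //; last by apply: IH; exact: ltnW.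
by have /andP[] : 0 <= mu (K - i.+2)%N < 1 by apply: mu_lt1; lia.
Qed.

Lemma dist_bound_last_le : dist_bound delta true K.-1 <= 5 / 6 * (1 - mu K).
Proof.
apply: le_trans (prod_mu_le _ _); last by rewrite K2 leqnn.
apply: le_trans (dist_bound_adj_le _ _) _; first by lia.
by have -> : (K - K.-1)%N = 1%N by lia.
Qed.

End AnchorRecursion.

(** * Plans and potentials *)

Section Transport.
Context {R : realType}.
Implicit Types (a c z : nat -> nat -> R) (l : R).

Definition cost a l (k q : nat) : R := l * res_dist a l k q.

Lemma cost00 a l : cost a l 0 0 = 0.
Proof. by rewrite /cost /res_dist /= mulr0. Qed.

Lemma cost0S a l j : l != 0 -> cost a l 0 j.+1 = 1.
Proof. by move=> l0; rewrite /cost /res_dist /= divff. Qed.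

Lemma costS0 a l i : l != 0 -> cost a l i.+1 0 = 1.
Proof. by move=> l0; rewrite /cost /res_dist /= divff. Qed.

Lemma residual_boundE N a l :
  residual_bound N a l = \sum_(0 <= n < N.+1) a N n * cost a l n N.+1.
Proof. by rewrite /residual_bound big_mkord. Qed.

Lemma cost_le_plan N a l i j z : 0 <= l -> mann_coeffs N a ->
  (i <= N)%N -> (j <= N)%N ->
  (forall k q, (k <= i)%N -> (q <= j)%N -> 0 <= z k q) ->
  (forall k, (k <= i)%N -> \sum_(0 <= q < j.+1) z k q = a i k) ->
  (forall q, (q <= j)%N -> \sum_(0 <= k < i.+1) z k q = a j q) ->
  cost a l i.+1 j.+1 <=
  l * \sum_(0 <= k < i.+1) \sum_(0 <= q < j.+1) z k q * cost a l k q.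
Proof.
move=> l0 aN iN jN z0 zr zc; rewrite ler_wpM2l //.
have [_ le_plan] := @res_dist_minP R N a l i j aN iN jN.
apply: le_trans (le_plan (\matrix_(k, q) z k q) _) _.
  split=> [k q|k|q]; first by rewrite mxE z0 ?leq_ord.
    by rewrite -zr ?leq_ord // big_mkord; apply: eq_bigr => q _; rewrite mxE.
  by rewrite -zc ?leq_ord // big_mkord; apply: eq_bigr => k _; rewrite mxE.
rewrite /plan_cost big_mkord le_eqVlt; apply/orP; left; apply/eqP.
apply: eq_bigr => k _; rewrite big_mkord.
by apply: eq_bigr => q _; rewrite mxE.
Qed.

(** Weak duality; only pairs of positions that carry mass in both rows can
    receive mass, so the potentials are constrained on those alone. *)
Lemma cost_ge_dual N a l i j (u v : nat -> R) : 0 <= l -> mann_coeffs N a ->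
  (i <= N)%N -> (j <= N)%N ->
  (forall k q, (k <= i)%N -> (q <= j)%N -> a i k != 0 -> a j q != 0 ->
     u k + v q <= cost a l k q) ->
  l * (\sum_(0 <= k < i.+1) a i k * u k + \sum_(0 <= q < j.+1) a j q * v q)
  <= cost a l i.+1 j.+1.
Proof.
move=> l0 aN iN jN uv; rewrite ler_wpM2l //.
have [[z [z0 zr zc] <-] _] := @res_dist_minP R N a l i j aN iN jN.
rewrite !big_mkord /plan_cost.
under eq_bigr do rewrite -zr mulr_suml.
under [X in _ + X]eq_bigr do rewrite -zc mulr_suml.
rewrite [X in _ + X]exchange_big -big_split /=; apply: ler_sum => k _.
rewrite -big_split /=; apply: ler_sum => q _; rewrite -mulrDr.
have zk : z k q <= a i k.
  by rewrite -zr (bigD1 q) //= lerDl sumr_ge0.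
have zq : z k q <= a j q.
  by rewrite -zc (bigD1 k) //= lerDl sumr_ge0.
have [zE|zN0] := eqVneq (z k q) 0; first by rewrite zE !mul0r.
have zp : 0 < z k q by rewrite lt_def zN0 z0.
apply: ler_wpM2l; first exact: z0.
apply: uv; rewrite ?leq_ord // gt_eqF // (lt_le_trans zp) //.
Qed.

Lemma cost_diag N a l i : 0 <= l -> mann_coeffs N a -> (i <= N.+1)%N ->
  cost a l i i <= 0.
Proof.
move=> l0 aN; elim/ltn_ind: i => -[_ _|i IH iN]; first by rewrite cost00.
have [a0 a1 _] := aN i iN.
pose z k q : R := if q == k then a i k else 0.
apply: le_trans (cost_le_plan N a l i i z l0 aN iN iN _ _ _) _.
- by move=> k q ki _; rewrite /z; case: ifP => // _; exact: a0.
- by move=> k ki; rewrite /z -big_mkcond big_nat1_eq ltnS ki.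
- move=> q qi; rewrite /z; under eq_bigr do rewrite eq_sym.
  by rewrite -big_mkcond big_nat1_eq ltnS qi.
- rewrite mulr_ge0_le0 // big_nat sumr_le0 // => k /andP[_ ki].
  rewrite (bigD1_seq k) ?mem_index_iota ?iota_uniq //=.
  rewrite big1 => [|q qk]; last by rewrite /z (negPf qk) mul0r.
  rewrite addr0 /z eqxx mulr_ge0_le0 ?a0 // IH //.
  by apply: leq_trans iN; exact: ltnW.
Qed.

(** Mass common to the positions below i stays in place at no cost, the last
    entry of row i fills the positions from i to j - 1, and what is left
    everywhere goes to j. *)
Lemma simple_plan N a l i j : 0 <= l -> mann_coeffs N a ->
  (i < j <= N)%N ->
  (forall k, (k < i)%N -> a j k <= a i k) ->
  \sum_(i <= q < j) a j q <= a i i ->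
  cost a l i.+1 j.+1 <=
  l * (\sum_(0 <= k < i) (a i k - a j k) * cost a l k j
       + \sum_(i.+1 <= q < j) a j q * cost a l i q
       + (a i i - \sum_(i <= q < j) a j q) * cost a l i j).
Proof.
move=> l0 aN /andP[ij jN] dec dom.
have iN : (i <= N)%N by exact: leq_trans (ltnW ij) jN.
have [ai0 ai1 _] := aN i iN; have [aj0 aj1 _] := aN j jN.
set S := \sum_(i <= q < j) a j q.
pose z k q : R :=
  if (k < i)%N then
    if q == k then a j k else if q == j then a i k - a j k else 0
  else if (q < i)%N then 0 else if (q < j)%N then a j q else a i i - S.
have row_lt k (w : nat -> R) : (k < i)%N ->
    \sum_(0 <= q < j.+1) z k q * w q = a j k * w k + (a i k - a j k) * w j.
  move=> ki; have kj := ltn_trans ki ij.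
  rewrite big_nat_recr //= /z ki eqxx [j == k]gtn_eqF //; congr (_ + _).
  rewrite (bigD1_seq k) ?mem_index_iota ?iota_uniq //= eqxx big_nat_cond.
  rewrite big1 ?addr0 // => q /andP[/andP[_ qj] /negPf ->].
  by rewrite ltn_eqF // mul0r.
have row_i (w : nat -> R) : \sum_(0 <= q < j.+1) z i q * w q =
    \sum_(i <= q < j) a j q * w q + (a i i - S) * w j.
  rewrite big_nat_recr //= /z !ltnn [(j < i)%N]ltnNge (ltnW ij) /=.
  congr (_ + _); rewrite (big_cat_nat (leq0n i) (ltnW ij)) //= big_nat big1 ?add0r.
    by apply: eq_big_nat => q /andP[iq qj]; rewrite ltnNge iq /= qj.
  by move=> q /andP[_ ->]; rewrite mul0r.
apply: le_trans (cost_le_plan N a l i j z l0 aN iN jN _ _ _) _.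
- move=> k q ki qj; rewrite /z; case: ltnP => ki'.
    do 2?case: ifP => // _; first by apply: aj0; exact: leq_trans (ltnW ki') (ltnW ij).
    by rewrite subr_ge0 dec.
  case: ifP => // _; case: ifP => // _; first exact: aj0.
  by rewrite subr_ge0.
- move=> k; rewrite leq_eqVlt => /predU1P[->|ki].
    have := row_i (fun=> 1); under eq_bigr do rewrite mulr1.
    by under [X in _ = X + _]eq_bigr do rewrite mulr1; move=> ->; rewrite -/S; ring.
  have := row_lt k (fun=> 1) ki; under eq_bigr do rewrite mulr1.
  by move=> ->; ring.
- move=> q; rewrite leq_eqVlt => /predU1P[->|qj].
    rewrite big_nat_recr //= {2}/z ltnn [(j < i)%N]ltnNge (ltnW ij) /= ltnn.
    under eq_big_nat => k /andP[_ ki].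
      rewrite /z ki gtn_eqF ?(ltn_trans ki ij) // eqxx; over.
    move: ai1 aj1; rewrite -!(big_mkord xpredT) !big_nat_recr //=.
    rewrite (big_cat_nat (leq0n i) (ltnW ij)) //= -/S sumrB => ai1 aj1; lra.
  rewrite big_nat_recr //=; have [qi|iq] := ltnP q i.
    rewrite {2}/z ltnn qi addr0 (bigD1_seq q) ?mem_index_iota ?iota_uniq //=.
    rewrite {1}/z qi eqxx big_nat_cond big1 ?addr0 // => k.
    move=> /andP[/andP[_ ki]]; rewrite /z ki eq_sym => /negPf ->.
    by rewrite ltn_eqF.
  rewrite {2}/z ltnn ltnNge iq /= qj big_nat big1 ?add0r // => k /andP[_ ki].
  by rewrite /z ki gtn_eqF ?(leq_trans ki iq) // ltn_eqF.
rewrite ler_wpM2l // big_nat_recr //= row_i addrA.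
under eq_big_nat => k /andP[_ ki] do rewrite row_lt //.
rewrite big_split /= (big_ltn ij).
have diag k : (k <= i)%N -> a j k * cost a l k k <= 0.
  move=> ki; rewrite mulr_ge0_le0 ?aj0 ?(leq_trans ki (ltnW ij)) //.
  by rewrite (cost_diag N) // (leq_trans ki) // ltnW.
have : \sum_(0 <= k < i) a j k * cost a l k k <= 0.
  by rewrite big_nat sumr_le0 // => k /andP[_ /ltnW /diag].
have := diag i (leqnn i).
lra.
Qed.

End Transport.

(** * The Halpern residual from below *)

Section Halpern.
Context {R : realType}.
Variables (N : nat) (m : nat -> R) (l : R).
Hypothesis l01 : 0 < l <= 1.
Hypothesis m0 : m 0 = 0.
Hypothesis m01 : forall n, (0 < n <= N)%N -> 0 < m n <= 1.

Lemma halpern_coeff0 n : halpern_coeff m n 0 = 1 - m n.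
Proof. by case: n => [|n]; rewrite /halpern_coeff //= m0 subr0. Qed.

Lemma halpern_coeff_diag n : (0 < n)%N -> halpern_coeff m n n = m n.
Proof. by case: n => // n _; rewrite /halpern_coeff /= eqxx. Qed.

Lemma halpern_coeff_mid n i : (0 < i)%N -> i != n -> halpern_coeff m n i = 0.
Proof.
by rewrite /halpern_coeff; case: n => [|n]; case: i => // i _ /negPf /= ->.
Qed.

Lemma halpern_sum n (w : nat -> R) : (0 < n)%N ->
  \sum_(0 <= i < n.+1) halpern_coeff m n i * w i = (1 - m n) * w 0 + m n * w n.
Proof.
move=> n0; rewrite big_nat_recr //= halpern_coeff_diag // big_ltn //.
rewrite halpern_coeff0 big_nat big1 ?addr0 // => i /andP[i0 iN].
by rewrite halpern_coeff_mid ?mul0r // ltn_eqF.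
Qed.

Lemma halpern_mann : mann_coeffs N (halpern_coeff m).
Proof.
move=> n nN; have [->|n0] := posnP n.
  by rewrite big_ord1 /halpern_coeff /=; split=> // -[].
have /andP[mp m1] : 0 < m n <= 1 by apply: m01; rewrite n0.
split; last by rewrite halpern_coeff_diag.
  move=> i _; have [->|i0] := posnP i; first by rewrite halpern_coeff0 subr_ge0.
  have [->|ine] := eqVneq i n; first by rewrite halpern_coeff_diag // ltW.
  by rewrite halpern_coeff_mid.
rewrite -(big_mkord xpredT); under eq_bigr do rewrite -[halpern_coeff _ _ _]mulr1.
by rewrite halpern_sum //; ring.
Qed.

Lemma sum_off0 (p : nat -> R) n c : \sum_(0 <= k < n.+1) p k = 1 ->
  \sum_(0 <= k < n.+1) p k * (if k == 0%N then 0 else c) = (1 - p 0) * c.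
Proof.
move=> s1; rewrite big_ltn // in s1; rewrite big_ltn //= mulr0 add0r -s1.
rewrite [p 0%N + _]addrC addrK mulr_suml.
by apply: eq_big_nat => -[].
Qed.

(** The potentials are e - 1 on row n and 1 on row n + 1 away from position 0,
    and 0 at position 0. The condition e <= 2 is the constraint of the pair
    formed by the last position of row n and position 0, whose cost is 1. *)
Lemma halpern_cost_ge n e : (n < N)%N -> e <= 2 ->
  e <= cost (halpern_coeff m) l n n.+1 ->
  l * (m n.+1 - m n + m n * e) <= cost (halpern_coeff m) l n.+1 n.+2.
Proof.
move=> nN e2 ec; have /andP[l0 _] := l01; have lN0 := lt0r_neq0 l0.
pose u k : R := if k == 0%N then 0 else e - 1.
pose v q : R := if q == 0%N then 0 else 1.
have := cost_ge_dual N _ l n n.+1 u v (ltW l0) halpern_mann (ltnW nN) nN.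
have [_ s1 _] := halpern_mann n (ltnW nN).
have [_ s2 _] := halpern_mann n.+1 nN.
rewrite -!(big_mkord xpredT) in s1 s2.
rewrite /u /v !sum_off0 // !halpern_coeff0 => le.
apply: le_trans (le _) => {le}; first by rewrite ler_pM2l //; lra.
move=> [|k] [|q] kn qn /=.
- by rewrite cost00 addr0.
- by rewrite cost0S // add0r.
- by rewrite costS0 // => *; lra.
have [kE|kE] := eqVneq k.+1 n; last by rewrite halpern_coeff_mid ?eqxx.
have [qE|qE] := eqVneq q.+1 n.+1; last first.
  by rewrite [halpern_coeff _ n.+1 _]halpern_coeff_mid ?eqxx.
by rewrite kE qE subrK.
Qed.

(** While the anchors follow the recursion, the lower bound for consecutive rows
    is 1 - l m^n. Once they are saturated, the distance of consecutive rows is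
    l times the residual of the previous step, and so is the new residual. *)
Lemma halpern_residual_ge K : (0 < K <= N)%N ->
  (forall k, (k < K)%N -> l * m k.+1 = (1 + (l * m k) ^+ 2) / 2) ->
  (forall n, (K < n <= N)%N -> m n = 1) ->
  l ^+ (N - K) * (1 - l * m K ^+ 2) <= residual_bound N (halpern_coeff m) l.
Proof.
move=> /andP[K0 KN] rec sat; have /andP[l0 l1] := l01; have lN0 := lt0r_neq0 l0.
have start n : (n <= K)%N ->
    1 - l * m n <= cost (halpern_coeff m) l n n.+1 /\ 0 <= l * m n.
  elim: n => [|n IH] nK; first by rewrite m0 mulr0 subr0 cost0S.
  have [IH1 IH2] := IH (ltnW nK); split.
    apply: le_trans (halpern_cost_ge _ _ _ _ IH1); last 2 first.
    - exact: leq_trans nK KN.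
    - by lra.
    have := rec n nK; lra.
  by rewrite rec // divr_ge0 // addr_ge0 // sqr_ge0.
suff [e [_ ec h]] : exists e, [/\ e <= 2,
    e <= cost (halpern_coeff m) l N N.+1 &
    l ^+ (N - K) * (1 - l * m K ^+ 2) <= 1 - m N + m N * e].
  rewrite residual_boundE halpern_sum ?(leq_trans K0) // cost0S //.
  have /andP[mp _] : 0 < m N <= 1 by apply: m01; rewrite (leq_trans K0 KN) /=.
  have := ler_wpM2l (ltW mp) ec; lra.
rewrite -(subnKC KN) addKn.
have: (K + (N - K) <= N)%N by rewrite subnKC.
elim: (N - K)%N => [|t IH] tN.
  have [s1 s2] := start K (leqnn K).
  by exists (1 - l * m K); rewrite addn0; split=> //; lra.
rewrite addnS in tN *; have [e [e2 ec h]] := IH (ltnW tN).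
have mt : m (K + t).+1 = 1 by apply: sat; rewrite ltnS leq_addr.
have /andP[mp m1] : 0 < m (K + t)%N <= 1.
  by apply: m01; rewrite addn_gt0 K0 /= ltnW.
exists (l * (1 - m (K + t)%N + m (K + t)%N * e)); split.
- have : m (K + t)%N * e <= m (K + t)%N * 2 by rewrite ler_pM2l.
  nra.
- by have := halpern_cost_ge _ _ tN e2 ec; rewrite mt.
- by rewrite mt exprS -mulrA subrr add0r mul1r ler_pM2l.
Qed.

End Halpern.

(** * The optimal anchors before and after N_* *)

Section OptAnchor.
Context {R : realType}.
Variables (l : R) (N : nat).
Hypothesis hl : 5 / 8 < l <= 1.
Hypothesis hN : (2 <= N)%N.
Let m := opt_anchor l.
Let K := N_star l N.

Lemma opt_anchorS n : m n.+1 = Num.min 1 ((1 + (l * m n) ^+ 2) / (2 * l)).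
Proof. by []. Qed.

Lemma opt_anchor_bounds n : (0 < n)%N -> 0 < m n <= 1.
Proof.
have hl' := hl.
case: n => // n _; rewrite opt_anchorS lt_min ltr01 /= ge_min lexx /= andbT.
by apply: divr_gt0; [have := sqr_ge0 (l * m n); lra|lra].
Qed.

Lemma opt_anchor_unsat n : m n.+1 != 1 ->
  m n.+1 = (1 + (l * m n) ^+ 2) / (2 * l).
Proof. by rewrite opt_anchorS minEle; case: ifP => // _; rewrite eqxx. Qed.

Lemma opt_anchor_sat n : m n = 1 -> m n.+1 = 1.
Proof.
have hl' := hl.
move=> mn; rewrite opt_anchorS mn mulr1; apply/min_idPl.
by rewrite ler_pdivlMr; [have := sqr_ge0 (1 - l); nra|lra].
Qed.

Lemma opt_anchor1 : m 1 = 1 / (2 * l).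
Proof.
have hl' := hl.
rewrite opt_anchorS /= mulr0 expr0n addr0; apply/min_idPr.
by rewrite ler_pdivrMr; lra.
Qed.

Lemma opt_anchor_lt1 n : (0 < n <= 2)%N -> m n < 1.
Proof.
have hl' := hl.
have lN0 : l != 0 by rewrite gt_eqF; lra.
have m1 : m 1 < 1 by rewrite opt_anchor1 ltr_pdivrMr; lra.
case: n => [|[|[|n]]] // _; rewrite opt_anchorS gt_min ltxx /= opt_anchor1.
have -> : l * (1 / (2 * l)) = 1 / 2 by field.
by rewrite ltr_pdivrMr; lra.
Qed.

(** Since l > 5/8, the anchors m^1 and m^2 are below 1, so N_* >= 2. *)
Lemma N_star_props : [/\ (2 <= K <= N)%N,
  forall n, (0 < n <= K)%N -> m n < 1 &
  forall n, (K < n <= N)%N -> m n = 1].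
Proof.
have min_lt n : (0 < n)%N -> m n != 1 -> m n < 1.
  by move=> /opt_anchor_bounds /andP[_ m1] mN; rewrite lt_neqAle mN.
rewrite /K /N_star /n_star; case: pselect => [h|h].
  case: ex_minnP => s /andP[s1 /eqP sat] smin.
  have s2 : (2 <= s)%N.
    rewrite ltn_neqAle s1 andbT; apply/eqP => sE.
    by have := opt_anchor_lt1 2 isT; rewrite /m -sE in sat *; rewrite sat ltxx.
  split.
  - by rewrite leq_min s2 hN geq_minr.
  - move=> n /andP[n0]; rewrite leq_min => /andP[ns _].
    have [n1|n1] := leqP n 2; first by rewrite opt_anchor_lt1 // n0.
    apply: min_lt => //; apply/negP => /eqP mn.
    have := smin n.-1; rewrite -/m prednK // mn eqxx andbT.
    have -> : (0 < n.-1)%N by lia.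
    by move=> /(_ isT); lia.
  - move=> n /andP[]; rewrite gtn_min => /orP[sn _|Nn]; last by lia.
    rewrite -(subnKC sn); elim: (n - s.+1)%N => [|t IH]; first by rewrite addn0.
    by rewrite addnS opt_anchor_sat.
split=> [|n /andP[n0 nN]|n]; [by rewrite hN leqnn| |by lia].
have [n1|n1] := leqP n 2; first by rewrite opt_anchor_lt1 // n0.
apply: min_lt => //; apply/negP => mn; apply: h; exists n.-1.
rewrite prednK // mn andbT; lia.
Qed.

Lemma scaled_anchorS k : (k < K)%N -> l * m k.+1 = (1 + (l * m k) ^+ 2) / 2.
Proof.
have hl' := hl.
move=> kK; have [_ lt1 _] := N_star_props.
have lN0 : l != 0 by rewrite gt_eqF; lra.
by rewrite opt_anchor_unsat ?lt_eqF ?lt1 //; field.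
Qed.

End OptAnchor.

(** * The perturbed Dual-Halpern residual from above *)

Section DualHalpern.
Context {R : realType}.
Variables (N K : nat) (m : nat -> R) (d1 d2 l : R).
Hypothesis KN : (2 <= K <= N)%N.
Local Notation p := (pdh_picard_coeff K m d1 d2).

Lemma pdh_coeff0 n : (0 < n <= K)%N ->
  p n 0 = 1 - m K + (if n == 1%N then d1 else 0) - (if n == K then d2 else 0).
Proof.
move=> /andP[n0 nK]; rewrite /pdh_picard_coeff /= ltnNge nK /=.
have [n1|n1] := eqVneq n 1%N.
  by rewrite n1 /= ltn_eqF ?subr0 //; lia.
by rewrite gtn_eqF //; case: ifP => _; rewrite addr0 ?subr0.
Qed.

Lemma pdh_coeff_mid n i : (0 < i < n)%N -> (n <= K)%N ->
  p n i = m (K - i).+1 - m (K - i)%N.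
Proof.
move=> /andP[i0 ni] nK; rewrite /pdh_picard_coeff ltnNge (ltnW ni) /= ltnNge nK.
have [-> -> ->] : [/\ (n == 0%N) = false, (n == 1%N) = false & (i == 0%N) = false].
  by split; lia.
by rewrite ni.
Qed.

Lemma pdh_coeff_diag n : (0 < n <= K)%N ->
  p n n = m (K - n).+1 - (if n == 1%N then d1 else 0)
          + (if n == K then d2 else 0).
Proof.
move=> /andP[n0 nK]; rewrite /pdh_picard_coeff ltnn ltnNge nK /= gtn_eqF //.
have [->|n1] := eqVneq n 1%N.
  by rewrite /= ltn_eqF ?addr0; [congr (m _ - _); lia|lia].
case: ifP => [/eqP ->|_]; first by rewrite subnn subr0.
by rewrite subr0 addr0 addn1 subSn.
Qed.

Lemma pdh_coeff_picard n i : (K < n)%N -> (i <= n)%N -> p n i = (i == n)%:R.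
Proof. by move=> Kn ni; rewrite /pdh_picard_coeff ltnNge ni /= Kn. Qed.

Lemma sum_anchor i j : (i <= j <= K.+1)%N ->
  \sum_(i <= q < j) (m (K - q).+1 - m (K - q)%N)
  = m (K.+1 - i)%N - m (K.+1 - j)%N.
Proof.
move=> /andP[ij jK].
rewrite (eq_big_nat _ _ (F2 := fun q => - m (K.+1 - q.+1)%N - - m (K.+1 - q)%N)).
  by rewrite (telescope_sumr (fun q => - m (K.+1 - q)%N)) // opprK addrC.
by move=> q /andP[_ qj]; rewrite opprK addrC subSS subSn //; lia.
Qed.

Hypothesis m0 : m 0 = 0.
Hypothesis m1 : 0 < m 1.
Hypothesis m_step : forall k, (k < K)%N -> m k <= m k.+1.
Hypothesis d1P : 0 <= d1 < m K.
Hypothesis d2P : 0 <= d2 <= 1 - m K.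

Lemma pdh_mann : mann_coeffs N p.
Proof.
have [[d1_0 d1_m] [d2_0 d2_m]] := (andP d1P, andP d2P).
have mpos k : (0 < k <= K)%N -> 0 < m k.
  case: k => // k /=; elim: k => [|k IH] kK //.
  by apply: lt_le_trans (m_step _ kK); apply: IH; exact: ltnW.
move=> n nN; have [n0|n0] := posnP n.
  by rewrite n0 big_ord1 /pdh_picard_coeff /=; split=> // -[].
have [Kn|nK] := ltnP K n.
  split; last by rewrite pdh_coeff_picard // eqxx.
    by move=> i ni; rewrite pdh_coeff_picard.
  rewrite big_ord_recr /= pdh_coeff_picard // eqxx big1 ?add0r // => i _.
  by rewrite pdh_coeff_picard ?ltn_eqF // ltnW.
have diag_gt0 : 0 < p n n.
  rewrite pdh_coeff_diag ?n0 //; have [->|n1] := eqVneq n 1%N.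
    rewrite ltn_eqF ?addr0 ?subr_gt0 //; last by lia.
    by have -> : (K - 1).+1 = K by lia.
  rewrite subr0; have := mpos (K - n).+1; case: ifP => _; last by rewrite addr0; apply; lia.
  by move=> mp; rewrite ltr_wpDr // mp //; lia.
split=> //.
  move=> i; rewrite leq_eqVlt => /predU1P[->|ni]; first exact: ltW.
  have [->|i0] := posnP i.
    rewrite pdh_coeff0 ?n0 //.
    by do 2 case: ifP => _; lra.
  by rewrite pdh_coeff_mid ?i0 // subr_ge0 m_step //; lia.
rewrite -(big_mkord xpredT) big_nat_recr //= big_ltn // pdh_coeff0 ?n0 //.
rewrite pdh_coeff_diag ?n0 //.
rewrite (eq_big_nat _ _ (F2 := fun q => m (K - q).+1 - m (K - q)%N)).
  rewrite sum_anchor; last by lia.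
  rewrite subSS subn0 subSn //; ring.
by move=> q qn; rewrite pdh_coeff_mid.
Qed.

Hypothesis l0 : 0 < l.
Hypothesis dec : forall i j : nat, (i < j <= N)%N -> p j i <= p j.-1 i.
Hypothesis dom : forall i j : nat, (i < j <= N)%N ->
  \sum_(i <= q < j) p j q <= p i i.

Lemma pdh_dec i j k : (k <= i)%N -> (i <= j <= N)%N -> p j k <= p i k.
Proof.
move=> ki /andP[ij]; rewrite -(subnKC ij).
elim: (j - i)%N => [|t IH] jN; first by rewrite addn0.
rewrite addnS in jN *; apply: le_trans (IH (ltnW jN)).
by apply: (dec k (i + t).+1); rewrite jN ltnS (leq_trans ki) ?leq_addr.
Qed.

Let mu k := l * m k.
Local Notation c := (cost p l).

(** In [simple_plan] rows i + 1 and j agree on the positions strictly between 0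
    and i + 1; position 0 has a surplus made of the perturbations only, and it
    is shipped at cost 1. The rest leaves position i + 1, at costs bounded by
    the previous level: [dist_bound true] for the first position and
    [dist_bound false] for the others, whose weights telescope. The previous
    level never involves row K, hence the single occurrence of d2. *)
Lemma pdh_cost_le i j : (i < j <= K)%N ->
  c i.+1 j.+1 <= dist_bound K mu (l * d1) (j == i.+1) i
                 + (if j == K then l * d2 else 0).
Proof.
have lN0 := lt0r_neq0 l0; have [K2 KN'] := andP KN.
elim: i j => [|i IH] j /andP[ij jK].
  have jN := leq_trans jK KN'.
  apply: le_trans (simple_plan N _ _ 0 j (ltW l0) pdh_mann _ _ _) _.
  - by rewrite ij.
  - by [].
  - by apply: dom; rewrite ij.
  have cj q : (0 < q)%N -> c 0 q = 1 by case: q => // q _; exact: cost0S.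
  rewrite big_geq // add0r cj // mulr1 [X in _ - X]big_ltn //.
  under [X in l * (X + _)]eq_big_nat => q /andP[q0 _] do rewrite cj // mulr1.
  rewrite (pdh_coeff0 j) ?ij //.
  have -> : p 0 0 = 1 by [].
  rewrite /= /mu; case: (j == 1%N); case: (j == K); rewrite le_eqVlt; apply/orP; left; apply/eqP; ring.
have jN := leq_trans jK KN'; have iK := leq_trans ij jK.
have ci q : (i.+1 < q <= j)%N -> c i.+1 q <= dist_bound K mu (l * d1) (q == i.+2) i.
  case: q => // q /andP[iq qj]; apply: le_trans (IH _ _) _; first by lia.
  by rewrite [q == K]ltn_eqF ?addr0 ?eqSS //; lia.
(* d and d' are the perturbations of position 0 in rows i + 1 and j *)
set d := if i == 0%N then d1 else 0.
set d' := if j == K then d2 else 0.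
have p0 : p i.+1 0 - p j 0 = d + d'.
  rewrite !pdh_coeff0 ?(ltnW iK) //; last by lia.
  rewrite eqSS -/d -/d' [i.+1 == K]ltn_eqF // [j == 1%N]gtn_eqF; last by lia.
  ring.
have sumj : \sum_(i.+1 <= q < j) p j q = m (K - i)%N - m (K.+1 - j)%N.
  rewrite (eq_big_nat _ _ (F2 := fun q => m (K - q).+1 - m (K - q)%N)).
    by rewrite sum_anchor //; lia.
  by move=> q qn; rewrite pdh_coeff_mid //; lia.
have pd : p i.+1 i.+1 - \sum_(i.+1 <= q < j) p j q = m (K.+1 - j)%N - d.
  rewrite sumj pdh_coeff_diag; last by lia.
  rewrite [i.+1 == K]ltn_eqF // eqSS -/d -subSn ?subSS; last by lia.
  ring.
have pd0 : 0 <= m (K.+1 - j)%N - d by rewrite -pd subr_ge0 dom // ij.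
apply: le_trans (simple_plan N _ _ i.+1 j (ltW l0) pdh_mann _ _ _) _.
- by rewrite ij.
- by move=> k ki; apply: pdh_dec; [exact: ltnW|rewrite (ltnW ij)].
- by apply: dom; rewrite ij.
rewrite pd big_ltn // p0 big_nat big1 ?addr0; last first.
  move=> k /andP[k0 ki]; rewrite !pdh_coeff_mid ?subrr ?mul0r ?(ltnW iK) // k0 //.
  exact: ltn_trans ki ij.
have -> : c 0 j = 1 by rewrite -(ltn_predK ij) cost0S.
have dE : (match i with 0 => l * d1 | _.+1 => 0 end) = l * d.
  by rewrite /d; move: (i) => [|i'] //=; rewrite mulr0.
have d'E : (if j == K then l * d2 else 0) = l * d'.
  by rewrite /d'; case: ifP => //; rewrite mulr0.
rewrite [dist_bound _ _ _ _ _]/= dE d'E.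
have ci2 : c i.+1 i.+2 <= dist_bound K mu (l * d1) true i.
  by have := ci i.+2; rewrite eqxx; apply; rewrite ltnSn.
have [jE|jE] := eqVneq j i.+2.
  rewrite jE big_geq // addr0 -/(c _ _).
  rewrite jE subSS in pd0; have := ler_wpM2l pd0 ci2.
  move=> h; have := ler_wpM2l (ltW l0) h; rewrite /mu subSS; lra.
have ij2 : (i.+2 < j)%N by rewrite ltn_neqAle eq_sym jE.
have := ci j; rewrite (negPf jE) leqnn ij => /(_ isT) cj.
rewrite big_ltn // pdh_coeff_mid ?ij //.
have sumle : \sum_(i.+3 <= q < j) p j q * c i.+1 q <=
    (m (K - i.+2)%N - m (K.+1 - j)%N) * dist_bound K mu (l * d1) false i.
  rewrite -[(K - i.+2)%N]subSS -sum_anchor ?ij2 ?(leqW jK) // mulr_suml.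
  rewrite big_nat [leRHS]big_nat; apply: ler_sum => q /andP[iq qj].
  have q0 : (0 < q)%N := leq_trans (ltn0Sn _) iq.
  rewrite pdh_coeff_mid ?q0 // ler_wpM2l //.
    by rewrite subr_ge0 m_step // ltn_subrL q0 (ltnW K2).
  apply: le_trans (ci q _) _; last by rewrite gtn_eqF.
  by rewrite (ltn_trans _ iq) // ltnW.
have := ler_wpM2l pd0 cj.
have mi : 0 <= m (K - i.+2).+1 - m (K - i.+2)%N by rewrite subr_ge0 m_step // ltn_subrL (ltnW K2).
have := ler_wpM2l mi ci2.
rewrite (subnSK iK) -subnS => h1 h2.
have := ler_wpM2l (ltW l0) (lerD sumle (lerD h1 h2)); rewrite /mu.
lra.
Qed.

Let res n := \sum_(0 <= k < n.+1) p n k * c k n.+1.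

(** A Picard row is a point mass, so the only plan ships the whole previous row
    to it, at l times the residual of that row. *)
Lemma picard_residual_le t : (K + t <= N)%N -> res (K + t) <= l ^+ t * res K.
Proof.
elim: t => [|t IH] tN; first by rewrite addn0 expr0 mul1r.
rewrite addnS in tN *; have := IH (ltnW tN); set n := (K + t)%N => IHn.
have Kn : (K < n.+1)%N by rewrite ltnS leq_addr.
have off k : (k <= n)%N -> p n.+1 k = 0.
  by move=> kn; rewrite pdh_coeff_picard ?ltn_eqF // ltnW.
have [p0 _ _] := pdh_mann n (ltnW tN).
rewrite exprS -mulrA; apply: (@le_trans _ _ (l * res n)); last by rewrite ler_pM2l.
rewrite {1}/res big_nat_recr //= big_nat big1 => [|k /andP[_ kn]]; last first.
  by rewrite off ?mul0r.
rewrite add0r pdh_coeff_picard // eqxx mul1r.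
have S0 : \sum_(n <= q < n.+1) p n.+1 q = 0 by rewrite big_nat1 off.
apply: le_trans (simple_plan N _ _ n n.+1 (ltW l0) pdh_mann _ _ _) _.
- by rewrite ltnSn.
- by move=> k kn; rewrite off ?p0 // ltnW.
- by rewrite S0 p0.
rewrite S0 subr0 (big_geq (leqnn n.+1)) addr0 /res big_nat_recr //= ler_pM2l //.
rewrite lerD2r big_nat [leRHS]big_nat ler_sum // => k /andP[_ kn].
by rewrite off ?subr0 // ltnW.
Qed.

Hypothesis l1 : l <= 1.
Hypothesis muS : forall k, (k < K)%N -> mu k.+1 = (1 + mu k ^+ 2) / 2.
Hypothesis d1E : l * d1 = 3 / (16 * (K%:R * (K%:R + 1))).
Hypothesis d2E : 8 * (l * d2) = 1 - m K.

(** Without d2, [residual_near_far] gives the claim with d2 = 0. The shift d2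
    lowers the weight of position 0, whose cost is 1, by d2, raises the weight
    of the last position by d2 and raises all costs to row K by l d2. *)
Lemma dual_halpern_residual_le :
  res K <= 1 - l * m K ^+ 2 - l * (d2 ^+ 2 / 3 + d1 ^+ 2).
Proof.
have [K2 KN'] := andP KN; have [d2_0 _] := andP d2P.
have lN0 := lt0r_neq0 l0.
have mu0 : mu 0 = 0 by rewrite /mu m0 mulr0.
have near_far := residual_near_far _ _ mu0 muS K2.
have last_le := dist_bound_last_le _ _ mu0 muS K2.
rewrite -d1E in near_far last_le.
have cn n : (0 < n < K)%N -> c n K.+1 <= dist_bound K mu (l * d1) false n.-1 + l * d2.
  case: n => // n nK; have := pdh_cost_le n K.
  by rewrite eqxx [K == n.+1]gtn_eqF //; apply; rewrite (ltnW nK) leqnn.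
have cK : c K K.+1 <= dist_bound K mu (l * d1) true K.-1 + l * d2.
  have := pdh_cost_le K.-1 K; rewrite prednK ?(ltnW K2) // !eqxx; apply.
  by rewrite leqnn.
have resE : l * res K = l * (1 - m K - d2)
    + \sum_(1 <= n < K) (mu (K - n).+1 - mu (K - n)%N) * c n K.+1
    + (mu 1 + l * d2) * c K K.+1.
  rewrite /res big_nat_recr //= big_ltn ?(ltnW K2) // cost0S // mulr1.
  rewrite pdh_coeff0 ?pdh_coeff_diag ?(ltnW K2) ?leqnn // eqxx.
  rewrite [K == 1%N]gtn_eqF // subnn subr0 addr0 !mulrDr mulr_sumr.
  congr (_ + _ + _); last by rewrite /mu; ring.
  apply: eq_big_nat => n nK; rewrite pdh_coeff_mid // /mu; ring.
have sumc : \sum_(1 <= n < K) (mu (K - n).+1 - mu (K - n)%N) * c n K.+1 <=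
    \sum_(1 <= n < K) (mu (K - n).+1 - mu (K - n)%N)
                      * dist_bound K mu (l * d1) false n.-1
    + l * d2 * (mu K - mu 1).
  have -> : mu K - mu 1 = \sum_(1 <= n < K) (mu (K - n).+1 - mu (K - n)%N).
    under eq_bigr do rewrite -mulrBr.
    rewrite -mulr_sumr sum_anchor ?(ltnW K2) ?leqnSn //.
    by rewrite -mulrBr subSS subn0 subSnn.
  rewrite mulr_sumr -big_split /= big_nat [leRHS]big_nat.
  apply: ler_sum => n nK.
  rewrite [l * d2 * _]mulrC -mulrDr ler_wpM2l ?cn // subr_ge0.
  have /andP[n0 _] := nK.
  by rewrite ler_pM2l // m_step // ltn_subrL n0 (ltnW K2).
have ld2 : 0 <= l * d2 by rewrite mulr_ge0 // ltW.
have wK : 0 <= mu 1 + l * d2 by rewrite addr_ge0 // mulr_ge0 // ltW.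
have {}cK := ler_wpM2l wK cK.
have {}last_le := ler_wpM2l ld2 last_le.
have mK : mu K <= m K by rewrite ler_piMl //; have [] := andP d1P; lra.
(* what remains of 1 - mu_K after removing the 5/6 of [dist_bound_last_le] and
   the quadratic term in d2 *)
have slack : 0 <= l * d2 * ((1 - mu K) / 6 - 4 / 3 * (l * d2)).
  by apply: mulr_ge0 => //; have := d2E; lra.
rewrite -(ler_pM2l l0) resE.
rewrite /mu in near_far sumc cK last_le slack *.
lra.
Qed.

End DualHalpern.

(** * Comparison of the two residuals *)

Theorem theorem4 (R : realType) (N : nat) (l : R)
  (hN : (2 <= N)%N) (hl : 5 / 8 < l <= 1)
  (h1 : forall i j : nat, (i < j <= N)%N ->
          pert_coeff l N j i <= pert_coeff l N j.-1 i)
  (h2 : forall i j : nat, (i < j <= N)%N ->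
          \sum_(i <= q < j) pert_coeff l N j q <= pert_coeff l N i i) :
  [/\ 0 < delta2 l N, 0 < delta1 l N &
      residual_bound N (pert_coeff l N) l <=
      residual_bound N (halpern_coeff (opt_anchor l)) l
      - l ^+ (N - N_star l N + 1) * (delta2 l N ^+ 2 / 3 + delta1 l N ^+ 2)].
Proof.
have [KN lt1 sat] := N_star_props l N hl hN.
have muS := scaled_anchorS l N hl hN.
move: h1 h2; rewrite /pert_coeff /delta1 /delta2.
set K := N_star l N in KN lt1 sat muS *; set m := opt_anchor l.
set d1 := 3 / _; set d2 := (1 - m K) / _ => dec dom.
have [l58 l1] := andP hl; have l0 : 0 < l by lra.
have lN0 := lt0r_neq0 l0; have [K2 KN'] := andP KN.
have k2 : 2 <= K%:R :> R by rewrite ler_nat.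
have mK : m K < 1 by apply: lt1; rewrite leqnn andbT ltnW.
have d1E : l * d1 = 3 / (16 * (K%:R * (K%:R + 1))).
  by rewrite /d1; field; rewrite lN0 !gt_eqF //; lra.
have d2E : 8 * (l * d2) = 1 - m K by rewrite /d2; field.
have d1_gt0 : 0 < d1.
  by rewrite divr_gt0 // !mulr_gt0 //; lra.
have d2_gt0 : 0 < d2 by rewrite divr_gt0 ?subr_gt0 ?mulr_gt0.
have d1P : 0 <= d1 < m K.
  rewrite ltW //= -(ltr_pM2l l0) d1E.
  have /andP[_ h] := @delta_bounds R K K2.
  have : 1 / 2 <= l * m K.
    by apply: (mu_ge_half K (fun k => l * m k) muS); rewrite leqnn andbT ltnW.
  lra.
have d2P : 0 <= d2 <= 1 - m K.
  rewrite ltW //= -d2E.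
  have : 0 < d2 * (8 * l - 1) by rewrite mulr_gt0 //; lra.
  lra.
have m_step k : (k < K)%N -> m k <= m k.+1.
  move=> kK; rewrite -(ler_pM2l l0).
  exact: (mu_step K (fun k => l * m k) muS).
have m01 n : (0 < n)%N -> 0 < m n <= 1 by exact: opt_anchor_bounds.
have m1_gt0 : 0 < m 1 by have /andP[] := m01 1%N isT.
split=> //.
have resH : l ^+ (N - K) * (1 - l * m K ^+ 2) <= residual_bound N (halpern_coeff m) l.
  apply: (halpern_residual_ge N m l) => //; first by rewrite l0.
    by move=> n /andP[/m01].
  by rewrite ltnW.
have := dual_halpern_residual_le N K m d1 d2 l KN erefl m1_gt0 m_step d1P d2P l0
  dec dom l1 muS d1E d2E.
rewrite -(ler_pM2l (exprn_gt0 (N - K) l0)).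
have := picard_residual_le N K m d1 d2 l KN m1_gt0 m_step d1P d2P l0 (N - K).
rewrite subnKC // => /(_ (leqnn N)); rewrite -residual_boundE exprD expr1.
move: resH; lra.
Qed.
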